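(* Let $d,n,k\ge 1$ and let $T : \Sigma^{\mathbb{Z}^d}\times Q\to\Sigma^{\mathbb{Z}^d}\times Q$ be a moving tape $(d,n,k)$-Turing machine, i.e. $T\in \mathrm{TM}_{\mathrm{fix}}(\mathbb{Z}^d,n,k)$. Then the following are equivalent: 1. $T$ is injective. 2. $T$ is surjective. 3. $T\in \mathrm{RTM}_{\mathrm{fix}}(\mathbb{Z}^d,n,k)$, i.e. $T$ is reversible. 4. $T$ preserves the uniform measure $\mu$: $\mu(T^{-1}(A))=\mu(A)$ for all Borel sets $A$. 5. $\mu(T(A))=\mu(A)$ for all Borel sets $A$.
   Context: Let $\Sigma=\{0,\dots,n-1\}$ and $Q=\{1,\dots,k\}$. $\Sigma^{\mathbb{Z}^d}$ carries the product topology of discrete topologies, $Q$ is discrete. The shift is $(\sigma_{\vec v}(x))_{\vec u}=x_{\vec u-\vec v}$. Moving tape Turing machine: given a function $f:\Sigma^F\times Q\to\Sigma^{F'}\times Q\times\mathbb{Z}^d$ with $F,F'$ finite subsets of $\mathbb{Z}^d$, define $T_f:\Sigma^{\mathbb{Z}^d}\times Q\to\Sigma^{\mathbb{Z}^d}\times Q$ as follows: if $f(x|_F,q)=(p,q',\vec d)$ then $T_f(x,q)=(\sigma_{\vec d}(y),q')$, where $y_{\vec u}=p_{\vec u}$ for $\vec u\in F'$ and $y_{\vec u}=x_{\vec u}$ for $\vec u\notin F'$. Maps of this form are the moving tape $(d,n,k)$-Turing machines; they form the monoid $\mathrm{TM}_{\mathrm{fix}}(\mathbb{Z}^d,n,k)$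 under composition. $T$ is reversible if there is a moving tape $(d,n,k)$-Turing machine $T^{-1}$ with $T\circ T^{-1}=T^{-1}\circ T=\mathrm{id}$; the reversible ones form the group $\mathrm{RTM}_{\mathrm{fix}}(\mathbb{Z}^d,n,k)$. The uniform measure $\mu$ on the Borel sets of $\Sigma^{\mathbb{Z}^d}\times Q$ is the product of the uniform Bernoulli measure on $\Sigma^{\mathbb{Z}^d}$ and the uniform probability measure on $Q$: for $F\subset\mathbb{Z}^d$ finite, $p\in\Sigma^F$, $q\in Q$, $\mu(\{x: x|_F=p\}\times\{q\})=\frac{1}{k n^{|F|}}$. *)

(* Defs.v *)
From HB Require Import structures.
From mathcomp Require Import all_boot all_order all_algebra.
From mathcomp Require Import finmap.
From mathcomp Require Import all_classical all_reals all_analysis.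
Set Implicit Arguments.
Unset Strict Implicit.
Unset Printing Implicit Defensive.
Import Order.TTheory GRing.Theory Num.Theory.
Local Open Scope classical_set_scope.
Local Open Scope ring_scope.

(* A finite set of n elements with the discrete topology, used both for the tape
   symbols and for the states, so that the k states are numbered from 0. It is
   pointed, as measurable types require, only when nonempty; this is why sizes
   are written n.+1 and k.+1 below whenever measures are involved. *)
Definition alphabet n : Type := discrete_topology 'I_n.
HB.instance Definition _ n := Finite.copy (alphabet n) 'I_n.
HB.instance Definition _ n :=
  DiscreteTopology.copy (alphabet n) (discrete_topology 'I_n).
HB.instance Definition _ n := isPointed.Build (alphabet n.+1) (ord0 : 'I_n.+1).

Definition config d n : Type := {ptws 'rV[int]_d -> alphabet n}.
HB.instance Definition _ d n :=
  Topological.copy (config d n) {ptws 'rV[int]_d -> alphabet n}.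
HB.instance Definition _ d n :=
  Pointed.copy (config d n.+1) {ptws 'rV[int]_d -> alphabet n.+1}.

Notation tm_space d n k := (config d n * alphabet k)%type.
Notation borel_tm_space d n k :=
  (g_sigma_algebraType (@open (tm_space d n k))).

Section machines.
Variables d n k : nat.
Implicit Types (F : {fset 'rV[int]_d}) (x : config d n).

Definition shift (v : 'rV[int]_d) x : config d n := fun u => x (u - v).

Definition restr F x : {ffun F -> alphabet n} := [ffun u => x (val u)].

Definition overwrite F (p : {ffun F -> alphabet n}) x : config d n :=
  fun u => if insub u is Some u' then p u' else x u.

Definition local_rule F F' : Type :=
  {ffun F -> alphabet n} * alphabet k ->
  {ffun F' -> alphabet n} * alphabet k * 'rV[int]_d.

Definition moving_tape_map F F' (f : local_rule F F')
    (c : tm_space d n k) : tm_space d n k :=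
  let: (p, q, v) := f (restr F c.1, c.2) in (shift v (overwrite p c.1), q).

Definition TM_fix : set (tm_space d n k -> tm_space d n k) :=
  [set T | exists F F' (f : local_rule F F'), T = moving_tape_map f].

Definition RTM_fix : set (tm_space d n k -> tm_space d n k) :=
  [set T | TM_fix T /\
    exists T', [/\ TM_fix T', T \o T' = id & T' \o T = id]].

End machines.

(* The cylinder values determine a measure on the Borel sets: the cylinders form
   a countable pi-system that generates them. *)
Definition is_uniform (R : realType) d n k
    (mu : {measure set (borel_tm_space d n.+1 k.+1) -> \bar R}) : Prop :=
  forall (F : {fset 'rV[int]_d}) (p : {ffun F -> alphabet n.+1})
    (q : alphabet k.+1),
  mu ([set x | restr F x = p] `*` [set q]) =
    ((k.+1 * n.+1 ^ #|` F|)%:R^-1)%:E.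

(* Existence: the base n.+1 digits of a Lebesgue-random point of [0, 1) are
   independent and uniform, so they can be used as the letters of a uniformly
   distributed configuration. *)
Section digits.
Variables (R : realType) (n : nat).
Local Notation N := n.+1.
Implicit Types (t : R) (m : nat) (a : int) (w : nat -> alphabet N).

Let Nm_gt0 m : 0 < N%:R ^+ m :> R.
Proof. by rewrite exprn_gt0 // ltr0n. Qed.

Let fl m t : int := Num.floor (t * N%:R ^+ m).

Let fl_itv m a : [set t | fl m t = a] =
  `[a%:~R / N%:R ^+ m, (a + 1)%:~R / N%:R ^+ m[%classic.
Proof.
apply/seteqP; split => t /=; rewrite in_itv /= ler_pdivrMr // ltr_pdivlMr //.
  by move/eqP; rewrite /fl floor_eq.
by rewrite -floor_eq => /eqP.
Qed.

Let fl_measurable m a :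
  measurable ([set t | fl m t = a] : set (measurableTypeR R)).
Proof. by rewrite fl_itv; exact: measurable_itv. Qed.

Let flS m t : 0 <= fl m.+1 t - N%:Z * fl m t < N%:Z.
Proof.
have E : t * N%:R ^+ m.+1 = N%:R * (t * N%:R ^+ m) by rewrite exprS mulrCA.
rewrite subr_ge0 ltrBlDr; apply/andP; split.
  by rewrite {2}/fl E floor_ge_int intrM -pmulrn ler_pM2l ?ltr0n // floor_le.
rewrite -[X in X + _]mulr1 -mulrDr addrC {1}/fl E floor_lt_int intrM -pmulrn.
by rewrite ltr_pM2l ?ltr0n // floorD1_gt.
Qed.

(* For t in [0, 1), the m-th digit of its base N expansion after the point. *)
Definition digit m t : alphabet N := inord (absz (fl m.+1 t - N%:Z * fl m t)%R).

Let flSE m t : fl m.+1 t = N%:Z * fl m t + (digit m t : 'I_N)%:Z.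
Proof.
have /andP[h0 h1] := flS m t.
have e : (absz (fl m.+1 t - N%:Z * fl m t)%R)%:Z = fl m.+1 t - N%:Z * fl m t.
  by rewrite gez0_abs.
rewrite /digit inordK; last by rewrite -ltz_nat e.
by rewrite e addrC subrK.
Qed.

Lemma measurable_digit m (c : alphabet N) :
  measurable ([set t | digit m t = c] : set (measurableTypeR R)).
Proof.
rewrite (_ : [set t | _] = \bigcup_(ab : int * int)
   if (inord (absz (ab.2 - N%:Z * ab.1)%R) : 'I_N) == c then
   [set t | fl m t = ab.1] `&` [set t | fl m.+1 t = ab.2] else set0).
  apply: countable_bigcupT_measurable => [|[a b]] /=.
    exact: countableP.
  by case: ifP => // _; exact: measurableI.
apply/seteqP; split => t /=.
  by move=> tc; exists (fl m t, fl m.+1 t) => //=; rewrite -/(digit m t) tc eqxx.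
by move=> [[a b] _] /=; case: ifP => //= /eqP <- [<- <-].
Qed.

Let K w m : int := iteri m (fun i a => N%:Z * a + (w i : 'I_N)%:Z) 0.

Let K_itv w m : 0 <= K w m < N%:Z ^+ m.
Proof.
elim: m => [//|m /andP[h0 h1]].
have hw := ltn_ord (w m : 'I_N).
rewrite /K /= -/(K w m) addr_ge0 ?mulr_ge0 //=.
apply: (@lt_le_trans _ _ (N%:Z * (K w m + 1))).
  by rewrite mulrDr mulr1 ltrD2l ltz_nat.
by rewrite exprS ler_pM2l // lezD1.
Qed.

Let digitsP w m t : 0 <= t < 1 ->
  (forall i, (i < m)%N -> digit i t = w i) <-> fl m t = K w m.
Proof.
move=> t01; elim: m => [|m IH].
  split=> // _; apply/eqP; rewrite /fl floor_eq expr0 mulr1 /=.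
  by rewrite mulr0z add0r mulr1z.
rewrite flSE /K /= -/(K w m); split=> [h|e].
  rewrite (h m) //; congr (_ * _ + _); apply/IH => i im.
  by apply: h; rewrite ltnS ltnW.
have [e1 e2] : fl m t = K w m /\ digit m t = w m.
  have hw := ltn_ord (w m : 'I_N).
  have hd := ltn_ord (digit m t : 'I_N).
  have e1 : fl m t = K w m.
    have := congr1 (divz ^~ N%:Z) e.
    by rewrite /= ![N%:Z * _]mulrC !divzMDl // !divz_small ?addr0 //
      ?absz_nat ?ltz_nat ?hw ?hd.
  split=> //; move: e; rewrite e1 => /addrI [] e; exact/val_inj.
move=> i; rewrite ltnS leq_eqVlt => /predU1P[->//|im].
exact: (proj2 IH e1).
Qed.

Let I01 : set (measurableTypeR R) := `[0, 1[%classic.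
Let mI01 : measurable I01. Proof. exact: measurable_itv. Qed.

Definition unit_lebesgue : {measure set (measurableTypeR R) -> \bar R} :=
  mrestr lebesgue_measure mI01.

Let wordE w m :
  unit_lebesgue [set t | forall i, (i < m)%N -> digit i t = w i] =
  ((N ^ m)%:R^-1)%:E.
Proof.
have /andP[K0 K1] := K_itv w m.
have K1' : (K w m + 1)%:~R / N%:R ^+ m <= 1 :> R.
  have := K1; rewrite -lezD1 -(ler_int R) rmorphXn /= -pmulrn => h.
  by rewrite ler_pdivrMr // mul1r.
have K0' : 0 <= (K w m)%:~R / N%:R ^+ m :> R.
  by rewrite divr_ge0 ?ler0z // ltW.
rewrite /unit_lebesgue /= /mrestr.
rewrite (_ : _ `&` _ = `[(K w m)%:~R / N%:R ^+ m, (K w m + 1)%:~R / N%:R ^+ m[%classic).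
  rewrite lebesgue_measure_itv /= lte_fin ltr_pM2r ?invr_gt0 // ltr_int ltzD1 lexx.
  by rewrite -EFinB -mulrBl intrD addrC addKr mul1r natrX.
rewrite -fl_itv; apply/seteqP; split => t /=.
  by move=> [h]; rewrite /I01 /= in_itv /= => t01; apply/digitsP.
move=> e; have t01 : 0 <= t < 1.
  have : [set t | fl m t = K w m] t by [].
  rewrite fl_itv /= in_itv /= => /andP[h1 h2].
  by rewrite (le_trans K0' h1) (lt_le_trans h2 K1').
by split; [apply/digitsP | rewrite /I01 /= in_itv].
Qed.

Let cyl m (S : {set 'I_m}) w : set (measurableTypeR R) :=
  [set t | forall i : 'I_m, i \in S -> digit i t = w i].

Let cyl_measurable m (S : {set 'I_m}) w : measurable (cyl S w).
Proof.
rewrite (_ : cyl S w = \bigcap_(i in [set` S]) [set t | digit i t = w i]).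
  by apply: fin_bigcap_measurable => // i _; exact: measurable_digit.
by apply/seteqP; split => t h i; apply: h.
Qed.

Lemma unit_lebesgue_digits m (S : {set 'I_m}) w :
  unit_lebesgue [set t | forall i : 'I_m, i \in S -> digit i t = w i] =
  ((N ^ #|S|)%:R^-1)%:E.
Proof.
rewrite -/(cyl S w); have [c] := ubnP #|~: S|.
elim: c S w => // c IH S w; rewrite ltnS => cS.
have [S0|/set0Pn[j]] := eqVneq (~: S) finset.set0.
  have -> : S = [set: 'I_m]%SET by rewrite -[S]finset.setCK S0 finset.setC0.
  rewrite cardsT card_ord -(wordE w); congr (unit_lebesgue _).
  apply/seteqP; split => t h i; first by move=> im; apply: (h (Ordinal im)); rewrite finset.inE.
  by move=> _; apply: h; exact: ltn_ord.
rewrite finset.inE => jS.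
pose w' (c : 'I_N) (i : nat) : alphabet N := if i == j then c else w i.
have -> : cyl S w = \big[setU/set0]_(c : 'I_N) cyl (j |: S)%SET (w' c).
  rewrite -bigcup_mkord_ord; apply/seteqP; split => t.
    move=> h; exists (digit j t : nat); first exact: ltn_ord.
    move=> i; rewrite !finset.inE => /predU1P[->|iS]; rewrite /w'.
      by rewrite eqxx inord_val.
    by rewrite (inj_eq val_inj) (negPf (memPn jS _ iS)) h.
  move=> [b _] h i iS; have := h i; rewrite !finset.inE iS orbT => /(_ isT).
  by rewrite /w' (inj_eq val_inj) (negPf (memPn jS _ iS)).
rewrite measure_bigsetU_ord //; last first.
  apply/trivIsetP => a b _ _ ab; apply/seteqP; split => // t [ha hb].
  have := ha j; have := hb j; rewrite !finset.inE eqxx /w' eqxx /=.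
  by move=> /(_ isT) -> /(_ isT) e; rewrite e eqxx in ab.
rewrite (eq_bigr (fun=> ((N ^ #|S|.+1)%:R^-1)%:E)); last first.
  move=> b _; apply: etrans (IH _ _ _) _; last by rewrite cardsU1 jS add1n.
  rewrite (leq_trans _ cS) // proper_card // finset.properEneq.
  rewrite finset.setCS finset.subsetUr andbT; apply/eqP => /setP/(_ j).
  by rewrite !finset.inE eqxx (negPf jS).
rewrite sumEFin sumr_const card_ord -[X in X%:E = _]mulr_natl expnS natrM invfM mulrA.
by rewrite divff ?mul1r // pnatr_eq0.
Qed.

End digits.

Section existence.
Variables (R : realType) (d n k : nat).

Let has_letters (s : seq ('rV[int]_d * alphabet n.+1)) (x : config d n.+1) :=
  all (fun c => x c.1 == c.2) s.

Let nbhs_config (x : config d n.+1) (A : set (config d n.+1)) : nbhs x A ->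
  exists2 s, has_letters s x & [set y | has_letters s y] `<=` A.
Proof.
pose F : set_system (config d n.+1) :=
  filter_from [set s | has_letters s x] (fun s => [set y | has_letters s y]).
have FF : Filter F.
  apply: filter_from_filter; first by exists [::].
  move=> s1 s2 /= h1 h2; exists (s1 ++ s2).
    by rewrite /has_letters /= all_cat; apply/andP.
  by move=> y /=; rewrite /has_letters all_cat => /andP[].
have Fx : F --> (x : {ptws 'rV[int]_d -> alphabet n.+1}).
  apply/cvg_sup => u B [C [[D oD <-] /= Dx DB]].
  exists [:: (u, x u)]; first by rewrite /has_letters /= eqxx.
  by move=> y /=; rewrite /has_letters /= andbT => /eqP yx; apply: DB; rewrite /= yx.
by move=> /Fx [s xs sA]; exists s.
Qed.

Let digit_config (t : R) : config d n.+1 := fun u => digit n (choice.pickle u) t.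

Let digit_point (q : alphabet k.+1) (t : measurableTypeR R) :
  borel_tm_space d n.+1 k.+1 := (digit_config t, q).

Let measurable_digit_point q : measurable_fun [set: _] (digit_point q).
Proof.
refine (@measurability _ _ (measurableTypeR R) (borel_tm_space d n.+1 k.+1) _ _
  (@open (tm_space d n.+1 k.+1)) erefl _).
move=> _ [V oV <-]; rewrite [_ `&` _]setTI.
rewrite (_ : digit_point q @^-1` V = \bigcup_(s : seq ('rV[int]_d * alphabet n.+1))
   if `[< forall x, has_letters s x -> V (x, q) >] then
   [set t | has_letters s (digit_config t)] else set0).
  apply: countable_bigcupT_measurable => [|s]; first exact: countableP.
  case: ifP => // _; elim: s => [|[u c] s IH].
    by rewrite (_ : [set _ | _] = setT) //; apply/seteqP; split.
  rewrite (_ : [set _ | _] = [set t | digit n (choice.pickle u) t = c] `&`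
    [set t | has_letters s (digit_config t)]).
    by apply: measurableI => //; exact: measurable_digit.
  apply/seteqP; split => t /=.
    by rewrite /has_letters /= => /andP[/eqP].
  by rewrite /has_letters /= => -[/eqP ? ?]; apply/andP.
apply/seteqP; split => t /=.
  move=> Vt; have : nbhs (digit_config t, q) V by exact: open_nbhs_nbhs.
  move=> [[/= A B] [/nbhs_config [s st sA] Bq] ABV]; exists s => //.
  case: asboolP => // -[] x xs; apply: (ABV (x, q)); split; first exact: sA.
  exact: nbhs_singleton Bq.
by move=> [s _]; case: asboolP => //= + st => /(_ _ st).
Qed.

Let state_law (i : nat) :
    {measure set (borel_tm_space d n.+1 k.+1) -> \bar R} :=
  measure_function_pushforward__canonical__measure_function_Measure
    (unit_lebesgue R) (measurable_digit_point (inord i)).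

Lemma exists_uniform :
  exists mu : {measure set (borel_tm_space d n.+1 k.+1) -> \bar R},
    is_uniform mu.
Proof.
exists (mscale (k.+1%:R^-1)%:nng (msum state_law k.+1)) => F p q.
rewrite /mscale /msum /= natrM invfM EFinM; congr (_ * _)%E.
transitivity (\sum_(i < k.+1) unit_lebesgue R
  (digit_point (inord i) @^-1` ([set x | restr F x = p] `*` [set q])))%E => //.
rewrite (bigD1 (q : 'I_k.+1)) //= big1 ?adde0 => [|i iq]; last first.
  rewrite (_ : _ @^-1` _ = set0) ?measure0 //.
  apply/seteqP; split => // t /= [_ e]; move/eqP: iq; apply.
  by rewrite -e inord_val.
pose m := (\max_(u : F) choice.pickle (val u)).+1.
have ltm (u : F) : (choice.pickle (val u) < m)%N.
  by rewrite ltnS (leq_bigmax u).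
pose pos (u : F) : 'I_m := Ordinal (ltm u).
have pos_inj : injective pos.
  by move=> u v [] /(pcan_inj choice.pickleK) /val_inj.
pose w (i : nat) : alphabet n.+1 :=
  if [pick u : F | pos u == i :> nat] is Some u then p u else ord0.
have wE u : w (pos u) = p u.
  rewrite /w; case: pickP => [v /eqP /val_inj /pos_inj -> //|/(_ u)].
  by rewrite eqxx.
have := unit_lebesgue_digits R [set pos u | u in [set: F]%SET]%SET w.
rewrite card_imset // cardsT -cardfE => <-.
congr (unit_lebesgue R _); apply/seteqP; split => t /=.
  by move=> [/ffunP e _] _ /imsetP[u _ ->]; rewrite wE -e ffunE.
move=> h; split; last exact: inord_val.
by apply/ffunP => u; rewrite ffunE -wE -(h (pos u)) ?imset_f.
Qed.

End existence.

Definition uniform_measure (R : realType) d n k :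
    {measure set (borel_tm_space d n.+1 k.+1) -> \bar R} :=
  projT1 (cid (exists_uniform R d n k)).

Lemma uniform_measureP (R : realType) d n k :
  is_uniform (uniform_measure R d n k).
Proof. exact: projT2 (cid (exists_uniform R d n k)). Qed.

(* Main.v *)
(* Let the window [G] contain all the cells that the machine reads or writes. On
   each cylinder over [G], the machine is a homeomorphism onto a cylinder over a
   translate of [G], and it preserves the measure there, since this holds for
   smaller cylinders and these determine a measure. As the cylinders over [G] are
   finitely many and partition the space, mu(T A) <= mu(A) for every Borel set
   [A], with equality if [T] is injective.
   If mu(T X) = mu(X) for the whole space X, then [T] is surjective: the image is
   a finite union of cylinders, hence clopen, and a missing point would leave out
   a cylinder of positive measure. If [T] is surjective but x <> x' have the same
   image, then a small cylinder B around x can be removed without losing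
   surjectivity, because T B lies in the image of the cylinder over [G] around
   x'; thus mu(X) <= mu(X \ B), which is absurd. The inverse of a bijective [T] is
   a machine that reads and writes a window containing all the translates of [G]. *)
Require Import Defs.
From mathcomp Require Import all_boot all_order all_algebra.
From mathcomp Require Import finmap.
From mathcomp Require Import all_classical all_reals all_analysis.
Set Implicit Arguments.
Unset Strict Implicit.
Unset Printing Implicit Defensive.
Import Order.TTheory GRing.Theory Num.Theory.
Local Open Scope classical_set_scope.
Local Open Scope ring_scope.

(** * Cylinders as a base of the topology and as a generating pi-system *)

Section cylinders.
Variables d n k : nat.
Local Notation X := (tm_space d n.+1 k.+1).
Local Notation BX := (borel_tm_space d n.+1 k.+1).
Implicit Types (W : {fset 'rV[int]_d}) (c : X) (A V : set X).

(** Given by a point instead of a pattern, so that a cylinder is never empty and can be recentred at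
    any of its points ([cyl_eq]). *)
Definition cyl W c : set X :=
  [set y | y.2 = c.2 /\ forall u, u \in W -> y.1 u = c.1 u].

Lemma cyl_refl W c : cyl W c c. Proof. by []. Qed.

Lemma cyl_sym W c y : cyl W c y -> cyl W y c.
Proof. by move=> [h1 h2]; split=> // u uW; rewrite h2. Qed.

Lemma cyl_eq W c y : cyl W c y -> cyl W y = cyl W c.
Proof.
move=> [e1 e2]; apply/seteqP; split=> z [h1 h2]; split; rewrite ?h1 ?e1 //.
  by move=> u uW; rewrite h2 // e2.
by move=> u uW; rewrite h2 // e2.
Qed.

Lemma cyl_sub W W' c : (forall u, u \in W -> u \in W') ->
  cyl W' c `<=` cyl W c.
Proof. by move=> WW' y [h1 h2]; split=> // u /WW'; exact: h2. Qed.

Lemma cylI W W' c : cyl W c `&` cyl W' c = cyl (W `|` W')%fset c.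
Proof.
apply/seteqP; split=> y.
  move=> [[h1 h2] [_ h3]]; split=> // u; rewrite inE => /orP[]; by [exact: h2|exact: h3].
by move=> h; split; apply: cyl_sub h => u uW; rewrite inE uW ?orbT.
Qed.

Lemma cyl_restr W c :
  cyl W c = [set x | restr W x = restr W c.1] `*` [set c.2].
Proof.
apply/seteqP; split=> y /=.
  by move=> [h1 h2]; split=> //; apply/ffunP => u; rewrite !ffunE h2 ?fsvalP.
move=> [/ffunP h1 h2]; split=> // u uW.
by have := h1 [` uW]%fset; rewrite !ffunE.
Qed.

Lemma open_cyl V c : open V -> V c -> exists W, cyl W c `<=` V.
Proof.
case: c => x q oV Vc.
pose F : set_system (config d n.+1) :=
  filter_from setT (fun W => [set y | forall u, u \in W -> y u = x u]).
have FF : Filter F.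
  apply: filter_from_filter; first by exists fset0.
  move=> W W' _ _; exists (W `|` W')%fset => // y h.
  by split=> u uW; apply: h; rewrite inE uW ?orbT.
(* Convergence in the product topology is checked cell by cell. *)
have Fx : F --> (x : {ptws 'rV[int]_d -> alphabet n.+1}).
  apply/cvg_sup => u B [C [[D oD <-] /= Dx DB]].
  exists [fset u]%fset => // y /= yx.
  by apply: DB; rewrite /= yx ?inE.
have [[/= A B] [nA nB] ABV] : nbhs (x, q) V by exact: open_nbhs_nbhs.
have [W _ WA] := Fx _ nA.
exists W => -[y r] [/= -> h]; apply: ABV; split; first exact: WA.
exact: nbhs_singleton nB.
Qed.

Lemma open_state (q : alphabet k.+1) : open [set y : X | y.2 = q].
Proof.
apply: (@open_comp _ _ snd [set q]) => [y _|]; first exact: cvg_snd.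
exact: discrete_open.
Qed.

Lemma open_letter (u : 'rV[int]_d) (a : alphabet n.+1) :
  open [set y : X | y.1 u = a].
Proof.
apply: (@open_comp X (alphabet n.+1) (fun y => y.1 u) [set a]) => [y _|].
  apply: (@continuous_comp X (config d n.+1) (alphabet n.+1) fst (@^~ u)).
    exact: cvg_fst.
  exact: (@proj_continuous _ (fun=> alphabet n.+1) u).
exact: discrete_open.
Qed.

Lemma cyl_bigcap W c : cyl W c =
  [set y | y.2 = c.2] `&` \bigcap_(u in [set` W]) [set y | y.1 u = c.1 u].
Proof. by []. Qed.

Lemma measurable_letter u a : measurable ([set y | y.1 u = a] : set BX).
Proof. by apply: sub_sigma_algebra; exact: open_letter. Qed.

Lemma measurable_state q : measurable ([set y | y.2 = q] : set BX).
Proof. by apply: sub_sigma_algebra; exact: open_state. Qed.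

Lemma measurable_cyl W c : measurable (cyl W c : set BX).
Proof.
rewrite cyl_bigcap; apply: measurableI; first exact: measurable_state.
by apply: fin_bigcap_measurable => // u _; exact: measurable_letter.
Qed.

Local Notation pattern W := ({ffun W -> alphabet n.+1} * alphabet k.+1)%type.

Definition pattern_of W c : pattern W := (restr W c.1, c.2).

(** A representative of each cylinder over [W], which indexes these cylinders by a finite type;
    cells outside [W] get the default letter. *)
Definition pattern_point W (i : pattern W) : X := (overwrite i.1 point, i.2).

Lemma overwriteE W (p : {ffun W -> alphabet n.+1}) (x : config d n.+1) u
    (uW : u \in W) : overwrite p x u = p [` uW]%fset.
Proof.
rewrite /overwrite; case: insubP => [v _ e|]; last by rewrite uW.
by congr (p _); apply: val_inj.
Qed.

Lemma overwrite_out W (p : {ffun W -> alphabet n.+1}) (x : config d n.+1) u :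
  u \notin W -> overwrite p x u = x u.
Proof. by move=> uW; rewrite /overwrite insubN. Qed.

Lemma cyl_pattern W c : cyl W c (pattern_point (pattern_of W c)).
Proof.
by split=> // u uW; rewrite /= (overwriteE _ _ uW) ffunE.
Qed.

Lemma pattern_pointK W : cancel (@pattern_point W) (pattern_of W).
Proof.
move=> [p q]; congr (_, _); apply/ffunP => u; rewrite ffunE.
by rewrite /= (overwriteE _ _ (fsvalP u)); congr (p _); apply: val_inj.
Qed.

(** The empty set is included because two cylinders may be disjoint. *)
Definition cylinders : set (set X) :=
  [set A | A = set0 \/ exists W c, A = cyl W c].

Lemma cylindersI : setI_closed cylinders.
Proof.
move=> A B [->|[W [c ->]]]; first by left; rewrite set0I.
move=> [->|[W' [c' ->]]]; first by left; rewrite setI0.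
have [->|/set0P[y [hy hy']]] := eqVneq (cyl W c `&` cyl W' c') set0.
  by left.
by right; exists (W `|` W')%fset, y; rewrite -cylI (cyl_eq hy) (cyl_eq hy').
Qed.

(** An open set is the union of the cylinders inside it, and there are only countably many
    cylinders. *)
Lemma borel_cylinders : @measurable _ BX = <<s cylinders >>.
Proof.
apply/seteqP; split; last first.
  apply: smallest_sub; first exact: sigma_algebra_measurable.
  by move=> A [->|[W [c ->]]]; [exact: measurable0|exact: measurable_cyl].
apply: smallest_sub; first exact: smallest_sigma_algebra.
move=> V oV.
have -> : V = \bigcup_(s : {W : {fset 'rV[int]_d} & pattern W})
    if `[< cyl (tag s) (pattern_point (tagged s)) `<=` V >]
    then cyl (tag s) (pattern_point (tagged s)) else set0.
  apply/seteqP; split=> [y Vy|y [s _]]; last first.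
    by case: asboolP => // h /h.
  have [W WV] := open_cyl oV Vy; exists (Tagged (fun W => pattern W) (pattern_of W y)) => //=.
  have h := cyl_pattern W y.
  by rewrite (cyl_eq h); case: asboolP.
apply: (@countable_bigcupT_measurable _ (g_sigma_algebraType cylinders)).
  exact: countableP.
move=> [W i]; case: asboolP => _; last exact: measurable0.
by apply: sub_sigma_algebra; right; exists W, (pattern_point i).
Qed.

Lemma eq_measure_cyl (R : realType) (m1 m2 : {measure set BX -> \bar R}) :
  (forall W c, m1 (cyl W c) = m2 (cyl W c)) ->
  (forall W c, (m1 (cyl W c) < +oo)%E) ->
  forall A : set BX, measurable A -> m1 A = m2 A.
Proof.
move=> m12 m1oo A mA.
(* The cylinders over the empty window are the state slices; [inord] lists them as a sequence
   covering the space. *)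
apply: (@measure_unique _ R BX cylinders (fun i => cyl fset0 (point, inord i))) => //.
- exact: borel_cylinders.
- exact: cylindersI.
- by move=> i; right; exists fset0, (point, inord i).
- apply/seteqP; split=> // y _; exists (y.2 : 'I_k.+1) => //; split=> //=.
  by rewrite inord_val.
by move=> B [->|[W [c ->]]]; rewrite ?measure0.
Qed.

End cylinders.

(** * The uniform measure on cylinders, and its finiteness *)

Section uniform.
Variables (R : realType) (d n k : nat).
Local Notation X := (tm_space d n.+1 k.+1).
Local Notation BX := (borel_tm_space d n.+1 k.+1).
Local Notation mu := (uniform_measure R d n k).
Implicit Types (W : {fset 'rV[int]_d}) (c : X).

Lemma uniform_cyl W c :
  mu (cyl W c) = ((k.+1 * n.+1 ^ #|` W|)%:R^-1)%:E.
Proof. by rewrite cyl_restr uniform_measureP. Qed.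

Lemma uniform_cyl_gt0 W c : (0 < mu (cyl W c))%E.
Proof. by rewrite uniform_cyl lte_fin invr_gt0 ltr0n muln_gt0 expn_gt0. Qed.

Lemma uniform_lty (A : set BX) : measurable A -> (mu A < +oo)%E.
Proof.
move=> mA; pose C (i : 'I_k.+1) : set BX := cyl fset0 (point, i).
apply: (@le_lt_trans _ _ (\sum_(i \in [set: 'I_k.+1]) mu (C i))%E).
  apply: content_sub_fsum => [|i _||y _] //; [exact: finite_finset|exact: measurable_cyl|].
  by exists (y.2 : 'I_k.+1).
rewrite fsbig_finite //=; apply: lte_sum_pinfty => i _.
by rewrite /C uniform_cyl ltry.
Qed.

End uniform.

(** * Machines as local maps, and their action on cylinders *)

Section moves.
Variables d n k : nat.
Local Notation X := (tm_space d n.+1 k.+1).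
Local Notation BX := (borel_tm_space d n.+1 k.+1).
Implicit Types (W : {fset 'rV[int]_d}) (c : X).

Definition translate W (w : 'rV[int]_d) : {fset 'rV[int]_d} :=
  [fset (u + w)%R | u in W]%fset.

Lemma mem_translate W w u : (u \in translate W w) = (u - w \in W).
Proof.
apply/imfsetP/idP => [[z /= zW ->]|uW]; first by rewrite addrK.
by exists (u - w); rewrite //= subrK.
Qed.

Lemma card_translate W w : #|` translate W w| = #|` W|.
Proof. by rewrite card_imfset //; exact: addIr. Qed.

(* [v c] is the displacement of the tape in one step from [c]; the letters seen
   or written by the machine lie in [G]. *)
Definition moves (G : {fset 'rV[int]_d}) (v : X -> 'rV[int]_d) (T : X -> X) :=
  (forall c y, cyl G c y ->
    v y = v c /\ cyl (translate G (v c)) (T c) (T y)) /\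
  (forall c u, u \notin G -> (T c).1 (u + v c) = c.1 u).

Lemma TM_fix_moves T : TM_fix T -> exists G v, moves G v T.
Proof.
move=> [F [F' [f ->]]]; exists (F `|` F')%fset.
exists (fun c => (f (restr F c.1, c.2)).2); split=> [c y [h2 h1]|c u] /=.
  have e : restr F y.1 = restr F c.1.
    by apply/ffunP => u; rewrite !ffunE h1 // inE fsvalP.
  rewrite /moving_tape_map h2 e; case: (f _) => -[p q] w /=; split=> //.
  split=> // u; rewrite mem_translate => uG /=; rewrite /Defs.shift.
  have [uF|uF] := boolP (u - w \in F'); first by rewrite !(overwriteE _ _ uF).
  by rewrite !overwrite_out // h1.
rewrite inE negb_or => /andP[_ uF'].
rewrite /moving_tape_map; case: (f _) => -[p q] w /=.
by rewrite /Defs.shift addrK overwrite_out.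
Qed.

Section moves_theory.
Variables (G : {fset 'rV[int]_d}) (v : X -> 'rV[int]_d) (T : X -> X).
Hypothesis Tmoves : moves G v T.

(** The inverse branch of [T] on the cylinder over [G] around [c]: inside [G] the letters are those
    of [c], elsewhere the displacement is undone. It is total, so that preimages under it make
    sense. *)
Definition local_inverse c (y : X) : X :=
  (fun u => if u \in G then c.1 u else y.1 (u + v c), c.2).

Lemma cyl_local_inverse c y : cyl G c (local_inverse c y).
Proof. by split=> //= u ->. Qed.

Lemma local_inverseK c y : cyl (translate G (v c)) (T c) y ->
  T (local_inverse c y) = y.
Proof.
have [Tloc Tout] := Tmoves; move=> [y2 y1].
have [vE [s2 s1]] := Tloc _ _ (cyl_local_inverse c y).
apply: injective_projections; last by rewrite s2 y2.
apply: funext => u; have [uG|uG] := boolP (u - v c \in G).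
  by rewrite s1 ?mem_translate // y1 // mem_translate.
have := Tout (local_inverse c y) _ uG; rewrite vE subrK => ->.
by rewrite /= (negPf uG) subrK.
Qed.

Lemma moves_inj c x y : cyl G c x -> cyl G c y -> T x = T y -> x = y.
Proof.
have [Tloc Tout] := Tmoves; move=> cx cy e.
have [[vx _] [vy _]] := (Tloc _ _ cx, Tloc _ _ cy).
apply: injective_projections; last by rewrite (proj1 cx) (proj1 cy).
apply: funext => u; have [uG|uG] := boolP (u \in G).
  by rewrite (proj2 cx) // (proj2 cy).
by rewrite -(Tout x) // -(Tout y) // vx vy e.
Qed.

(** Writing an image as a preimage gives access to measurability and to pushforward measures. *)
Lemma image_cylI c (A : set X) : T @` (cyl G c `&` A) =
  cyl (translate G (v c)) (T c) `&` local_inverse c @^-1` A.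
Proof.
apply/seteqP; split=> [_ [x [cx Ax] <-]|y [cy Ay]].
  have h := proj2 (proj1 Tmoves _ _ cx); split=> //=.
  have -> // : local_inverse c (T x) = x.
  apply: (moves_inj (cyl_local_inverse c _) cx).
  exact: local_inverseK.
exists (local_inverse c y); last exact: local_inverseK.
by split=> //; exact: cyl_local_inverse.
Qed.

Lemma image_cyl W c : (forall u, u \in G -> u \in W) ->
  T @` cyl W c = cyl (translate W (v c)) (T c).
Proof.
have [Tloc Tout] := Tmoves; move=> GW.
rewrite -(setIidr (cyl_sub (c := c) GW)) image_cylI.
apply/seteqP; split=> y.
  move=> [[y2 y1] [_ h]]; split=> // u; rewrite mem_translate => uW.
  have [uG|uG] := boolP (u - v c \in G); first by rewrite y1 // mem_translate.
  have := h _ uW; rewrite /= (negPf uG) subrK => ->.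
  by rewrite -(Tout _ _ uG) subrK.
move=> [y2 y1]; split.
  by split=> // u; rewrite mem_translate => /GW uW; rewrite y1 // mem_translate.
split=> //= u uW; case: ifP => // /negbT uG.
by rewrite y1 ?mem_translate ?addrK // Tout.
Qed.

(** Each coordinate of [local_inverse c] is either constant or a coordinate of the argument, so
    cylinders have measurable preimages. *)
Lemma measurable_local_inverse c :
  measurable_fun [set: BX] (local_inverse c : BX -> BX).
Proof.
refine (@measurability _ _ BX BX _ _ (@cylinders d n k) _ _).
  exact: borel_cylinders.
move=> _ [_ [->|[W [y ->]]] <-]; rewrite setTI ?preimage_set0 //.
rewrite cyl_bigcap preimage_setI preimage_bigcap; apply: measurableI.
  rewrite (_ : _ @^-1` _ = if c.2 == y.2 then setT else set0); first by case: ifP.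
  apply/seteqP; split=> z /=; first by move=> ->; rewrite eqxx.
  by case: eqP.
apply: fin_bigcap_measurable => // u _.
have [uG|uG] := boolP (u \in G).
  rewrite (_ : _ @^-1` _ = if c.1 u == y.1 u then setT else set0); first by case: ifP.
  apply/seteqP; split=> z /=; first by rewrite uG => ->; rewrite eqxx.
  by case: eqP => // e _; rewrite uG.
rewrite (_ : _ @^-1` _ = [set z | z.1 (u + v c) = y.1 u]).
  exact: measurable_letter.
by apply/seteqP; split=> z /=; rewrite (negPf uG).
Qed.

Lemma measurable_image_cylI c (A : set BX) : measurable A ->
  measurable (T @` (cyl G c `&` A) : set BX).
Proof.
move=> mA; rewrite image_cylI; apply: measurableI; first exact: measurable_cyl.
rewrite -[X in measurable X]setTI; exact: measurable_local_inverse.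
Qed.

Lemma image_bigcup_cyl (A : set X) : T @` A =
  \bigcup_(i in [set: {ffun G -> alphabet n.+1} * alphabet k.+1])
    T @` (cyl G (pattern_point i) `&` A).
Proof.
rewrite -image_bigcup; congr (_ @` _); apply/seteqP; split=> [y Ay|y [i _ []] //].
exists (pattern_of G y) => //; split=> //; apply: cyl_sym; exact: cyl_pattern.
Qed.

Lemma measurable_image (A : set BX) : measurable A ->
  measurable (T @` A : set BX).
Proof.
move=> mA; rewrite image_bigcup_cyl; apply: fin_bigcup_measurable => [|i _]; first exact: finite_finset.
exact: measurable_image_cylI.
Qed.

End moves_theory.
End moves.

(** * Measures of images, and their link with surjectivity and injectivity *)

Section image_measure.
Variables (R : realType) (d n k : nat).
Local Notation X := (tm_space d n.+1 k.+1).
Local Notation BX := (borel_tm_space d n.+1 k.+1).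
Local Notation mu := (uniform_measure R d n k).
Variables (G : {fset 'rV[int]_d}) (v : X -> 'rV[int]_d) (T : X -> X).
Hypothesis Tmoves : moves G v T.

(** Both sides are finite measures in [A], so cylinders suffice; there the window is only translated
    and keeps its cardinality. *)
Lemma uniform_image_cylI c (A : set BX) : measurable A ->
  mu (T @` (cyl G c `&` A)) = mu (cyl G c `&` A).
Proof.
move=> mA; rewrite (image_cylI Tmoves) (setIC (cyl G c)) (setIC (cyl _ (T c))).
have mC := measurable_cyl G c.
have mD := measurable_cyl (translate G (v c)) (T c).
pose m1 : {measure set BX -> \bar R} :=
  measure_function_pushforward__canonical__measure_function_Measure
    (mrestr mu mD) (measurable_local_inverse G v c).
pose m2 : {measure set BX -> \bar R} := mrestr mu mC.
apply: (@eq_measure_cyl _ _ _ _ m1 m2) => // W y.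
  rewrite /m1 /m2 /= /pushforward /mrestr setIC -(image_cylI Tmoves) (setIC (cyl G c)).
  (* If the two cylinders meet, recentring both at a common point makes their intersection a
     cylinder over a window containing [G]. *)
  have [->|/set0P[z [yz cz]]] := eqVneq (cyl W y `&` cyl G c) set0.
    by rewrite image_set0 !measure0.
  rewrite (esym (cyl_eq yz)) (esym (cyl_eq cz)) cylI (image_cyl Tmoves).
    by rewrite !uniform_cyl card_translate.
  by move=> u uG; rewrite inE uG orbT.
apply: uniform_lty; apply: measurableI => //.
rewrite -[X in measurable X]setTI; apply: measurable_local_inverse => //.
exact: measurable_cyl.
Qed.

Let pieces (A : set X) (i : {ffun G -> alphabet n.+1} * alphabet k.+1) :=
  cyl G (pattern_point i) `&` A.

Let trivIset_pieces A : trivIset setT (pieces A).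
Proof.
move=> i j _ _ [y [[yi _] [yj _]]].
rewrite -(pattern_pointK i) -(pattern_pointK j).
have : cyl G (pattern_point j) (pattern_point i).
  by rewrite -(cyl_eq yj); exact: cyl_sym.
by rewrite cyl_restr => -[/= e1 e2]; congr (_, _).
Qed.

Let uniform_pieces (A : set BX) : measurable A ->
  mu A = (\sum_(i \in setT) mu (pieces A i))%E.
Proof.
(* The decomposition into pieces is [image_bigcup_cyl] for the identity map. *)
move=> mA; rewrite -[in LHS](image_id A) (image_bigcup_cyl G).
under eq_bigcupr do rewrite image_id.
apply: measure_fin_bigcup => [||i _]; first exact: finite_finset.
  exact: trivIset_pieces.
by apply: measurableI => //; exact: measurable_cyl.
Qed.

(** The images of the pieces keep their measure but may overlap, so only subadditivity applies. *)
Lemma uniform_image_le (A : set BX) : measurable A -> (mu (T @` A) <= mu A)%E.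
Proof.
move=> mA; rewrite (uniform_pieces mA).
under eq_fsbigr do rewrite -uniform_image_cylI //.
apply: content_sub_fsum => [|i _||]; first exact: finite_finset.
- exact: (measurable_image_cylI Tmoves).
- exact: (measurable_image Tmoves).
by rewrite -image_bigcup_cyl.
Qed.

Lemma uniform_image_inj (A : set BX) : injective T -> measurable A ->
  mu (T @` A) = mu A.
Proof.
move=> Tinj mA; rewrite (uniform_pieces mA) (image_bigcup_cyl G).
under eq_fsbigr do rewrite -uniform_image_cylI //.
apply: measure_fin_bigcup => [||i _]; first exact: finite_finset.
  move=> i j _ _ [_ [[x xi <-] [y yj /Tinj e]]].
  by apply: (trivIset_pieces (A := A)) => //; exists x; split=> //; rewrite -e.
exact: (measurable_image_cylI Tmoves).
Qed.

(** The displacement depends only on the pattern on [G], so finitely many translates of [G]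
    occur. *)
Lemma moves_window :
  exists H : {fset 'rV[int]_d}, forall c u, u \in G -> u + v c \in H.
Proof.
exists (\big[fsetU/fset0]_(i : {ffun G -> alphabet n.+1} * alphabet k.+1)
  translate G (v (pattern_point i)))%fset => c u uG.
apply/bigfcupP; exists (pattern_of G c); first by rewrite mem_index_enum.
rewrite (proj1 (proj1 Tmoves _ _ (cyl_pattern G c))).
by rewrite mem_translate addrK.
Qed.

Lemma uniform_image_surj :
  mu (T @` [set: X]) = mu [set: X] -> forall c, exists c', T c' = c.
Proof.
move=> e c; apply: contrapT => nc.
have [H HP] := moves_window.
have disj : cyl H c `&` T @` [set: X] = set0.
  apply/seteqP; split=> // z [cz [x _ xz]].
  (* The image of [cyl G x] is a cylinder over a subset of [H]; containing [z], it also contains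
     [c]. *)
  have : (T @` cyl G x) c.
    rewrite (image_cyl Tmoves) // xz; apply: cyl_sym.
    apply: cyl_sub cz => u; rewrite mem_translate => /(HP x).
    by rewrite subrK.
  by case=> x' _ xc; apply: nc; exists x'.
have mT : measurable (T @` [set: X] : set BX).
  exact: (measurable_image Tmoves).
have mC := measurable_cyl H c.
have : (mu (cyl H c `|` T @` [set: X]) <= mu [set: X])%E.
  by apply: le_measure; rewrite ?inE //; exact: measurableU.
rewrite measureU // -e addeC leNgt lteDl ?uniform_cyl_gt0 //.
by rewrite ge0_fin_numE // uniform_lty.
Qed.

Lemma moves_surj_inj : (forall c, exists c', T c' = c) -> injective T.
Proof.
move=> Tsurj x x' e; apply: contrapT => xx'.
have dx : ~ cyl G x x'.
  by move=> h; apply: xx'; apply: (moves_inj Tmoves (cyl_refl G x) h).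
(* The second part makes the translate of [W] by [v x] contain that of [G] by [v x']; the first lets
   [image_cyl] apply. *)
pose W := (G `|` translate G (v x' - v x))%fset.
have WE : forall u, u \in G -> u \in W by move=> u uG; rewrite inE uG.
have sub : T @` cyl W x `<=` T @` cyl G x'.
  rewrite !(image_cyl Tmoves) // e; apply: cyl_sub => u.
  rewrite !mem_translate inE => uG; apply/orP; right.
  by rewrite mem_translate opprB addrA subrK.
have mW := measurable_cyl W x.
(* Whatever [cyl W x] reaches is also reached from [cyl G x'], which is disjoint from it. *)
have TC : T @` (~` cyl W x) = setT.
  apply/seteqP; split=> // c _; have [y <-] := Tsurj c.
  have [yW|yW] := pselect (cyl W x y); last by exists y.
  have [y' h <-] := sub _ (ex_intro2 _ _ y yW erefl).
  exists y' => // h'; apply: dx.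
  by rewrite -(cyl_eq (cyl_sub WE h')); exact: cyl_sym.
have := uniform_image_le (measurableC mW).
rewrite TC leNgt => /negP; apply.
rewrite -(setvU (cyl W x)) measureU ?setICl //; last exact: measurableC.
rewrite lteDl ?uniform_cyl_gt0 // ge0_fin_numE // uniform_lty //.
exact: measurableC.
Qed.

End image_measure.

(** * The inverse of a bijective machine is a machine *)

Lemma TM_fix_inverse d n k (T T' : tm_space d n.+1 k.+1 -> tm_space d n.+1 k.+1) :
  TM_fix T -> cancel T T' -> cancel T' T -> TM_fix T'.
Proof.
move=> /TM_fix_moves [G [v Tmoves]] TK T'K.
have [H HP] := moves_window Tmoves.
(* Writing precedes moving: the letter of [x] at [val u - v x] is put in cell [u], and the
   displacement [- v x] then brings it home. *)
pose g (i : {ffun H -> alphabet n.+1} * alphabet k.+1) :=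
  let x := T' (pattern_point i) in
  (finfun (fun u : H =>
     if val u - v x \in G then x.1 (val u - v x) else i.1 u), x.2, - v x).
exists H, H, g; apply: funext => z.
rewrite /moving_tape_map /g /= -/(pattern_of H z).
set x := T' (pattern_point _); have Tx : T x = pattern_point (pattern_of H z) by exact: T'K.
(* As [z] agrees with [T x] on [H], its preimage agrees with [x] on [G]. *)
have : (T @` cyl G x) z.
  rewrite (image_cyl Tmoves) // Tx.
  apply: cyl_sub (cyl_sym (cyl_pattern H z)) => u.
  by rewrite mem_translate => /(HP x); rewrite subrK.
move=> [y [y2 y1] <-]; rewrite TK.
have vE : v y = v x := proj1 (proj1 Tmoves _ _ (conj y2 y1)).
apply: injective_projections => //=; apply: funext => u.
rewrite /Defs.shift opprK.
have [uG|uG] := boolP (u \in G).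
  by rewrite (overwriteE _ _ (HP x _ uG)) ffunE /= addrK uG y1.
rewrite -(proj2 Tmoves _ _ uG) vE.
have [uH|uH] := boolP (u + v x \in H); last by rewrite overwrite_out.
by rewrite (overwriteE _ _ uH) ffunE /= addrK (negPf uG) ffunE.
Qed.

(** * The cycle of implications *)

Theorem theorem1 (R : realType) (d n k : nat)
    (T : tm_space d.+1 n.+1 k.+1 -> tm_space d.+1 n.+1 k.+1)
    (hT : TM_fix T) :
  let mu := uniform_measure R d.+1 n k in
  [<-> injective T;
       (forall c, exists c', T c' = c);
       RTM_fix T;
       (forall A : set (borel_tm_space d.+1 n.+1 k.+1),
          measurable A -> mu (T @^-1` A) = mu A);
       (forall A : set (borel_tm_space d.+1 n.+1 k.+1),
          measurable A -> mu (T @` A) = mu A)].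
Proof.
move=> mu; have [G [v Tmoves]] := TM_fix_moves hT.
have surj_inj := moves_surj_inj R Tmoves.
tfae.
- by move=> Tinj; apply: (uniform_image_surj (R := R) Tmoves); exact: (uniform_image_inj R Tmoves).
- move=> Tsurj; split=> //; have [T' T'K] := choice Tsurj.
  have TK : cancel T T' by move=> x; apply: surj_inj; rewrite ?T'K.
  exists T'; split; last 2 first.
  + by apply: funext => x; rewrite /= T'K.
  + by apply: funext => x; rewrite /= TK.
  exact: TM_fix_inverse hT TK T'K.
(* Preimages under [T] are images under its inverse, an injective machine. *)
- move=> [_ [T' [/TM_fix_moves [G' [v' T'moves]] TT' T'T]]] A mA.
  have TK x : T' (T x) = x by have := congr1 (@^~ x) T'T.
  have T'K x : T (T' x) = x by have := congr1 (@^~ x) TT'.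
  rewrite -(uniform_image_inj R T'moves (can_inj T'K) mA); congr (mu _).
  apply/seteqP; split=> [x Ax|_ [x Ax <-]]; last by rewrite /= T'K.
  by exists (T x).
(* Applied to the range of [T], whose preimage is the whole space, the hypothesis shows that the
   range has full measure. *)
- move=> h A mA.
  have Tinj : injective T.
    apply: surj_inj; apply: (uniform_image_surj (R := R) Tmoves).
    rewrite -h; last exact: (measurable_image Tmoves).
    by congr (mu _); apply/seteqP; split=> // x _; exists x.
  exact: (uniform_image_inj R Tmoves).
- move=> h; apply: surj_inj; apply: (uniform_image_surj (R := R) Tmoves).
  exact: h.
Qed.
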